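(* If $\mathbf{R}=A\cup B$ with $A\cap B=\emptyset$ and both $A$ and $B$ dense in $\mathbf{R}$, then neither $A$ nor $B$ (with the subspace topology) is rr-good.
   Context: For a Tychonoff space $X$, $\mathrm{C}(X)$ is the ring of continuous real-valued functions on $X$. It is partially ordered by the reduced ring order: $f\le_{\mathrm{rr}} g$ if and only if $f^2=fg$. The space $X$ is called rr-good if every pair $f,g\in \mathrm{C}(X)$ has an infimum (greatest lower bound) in the partial order $\le_{\mathrm{rr}}$. *)

(* Defs.v *)
From HB Require Import structures.
From mathcomp Require Import all_boot all_order all_algebra.
From mathcomp Require Import all_classical all_reals all_analysis.
Set Implicit Arguments.
Unset Strict Implicit.
Unset Printing Implicit Defensive.
Import Order.TTheory GRing.Theory Num.Theory.
Import numFieldNormedType.Exports.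
Local Open Scope classical_set_scope.
Local Open Scope ring_scope.

(* [continuousType X R] as a subring of the pointwise ring [X -> R]; it is only
   a [comPzRingType], as C(X) is the zero ring when X is empty. *)
Section continuous_ring.
Context (R : realType) (X : topologicalType).

Definition ctsfun : {pred X -> R} := mem [set f | continuous f].

Definition ctsfun_Sub (f : X -> R) (fP : f \in ctsfun) : continuousType X R :=
  mkcts (set_mem fP).

Lemma ctsfun_rect (K : continuousType X R -> Type) :
  (forall f (Pf : f \in ctsfun), K (ctsfun_Sub Pf)) -> forall u, K u.
Proof.
move=> Ksub u.
have uP : (u : X -> R) \in ctsfun by apply/mem_set; exact: cts_fun.
suff <- : ctsfun_Sub uP = u by exact: Ksub.
exact/continuousEP.
Qed.

Lemma ctsfun_valP f (Pf : f \in ctsfun) : ctsfun_Sub Pf = f :> (X -> R).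
Proof. by []. Qed.

HB.instance Definition _ :=
  isSub.Build (X -> R) (mem ctsfun) (continuousType X R) ctsfun_rect ctsfun_valP.

Lemma ctsfun_subring_closed : subring_closed ctsfun.
Proof.
split=> [|f g|f g]; rewrite !inE /=.
- exact: cst_continuous.
- by move=> cf cg x; apply: continuousB; [exact: cf|exact: cg].
- by move=> cf cg x; apply: continuousM; [exact: cf|exact: cg].
Qed.

HB.instance Definition _ := GRing.SubChoice_isSubComPzRing.Build (X -> R)
  (mem ctsfun) (continuousType X R) ctsfun_subring_closed.

End continuous_ring.

Fact rr_display : Order.disp_t. Proof. exact: Order.Disp tt tt. Qed.

(* Alias of the ring C(X) carrying the reduced ring order. *)
Definition rrC (R : realType) (X : topologicalType) : Type := continuousType X R.

Section reduced_ring_order.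
Context (R : realType) (X : topologicalType).

HB.instance Definition _ := Choice.on (rrC R X).
HB.instance Definition _ := GRing.ComPzRing.on (rrC R X).

Definition rr_le : rel (rrC R X) := fun f g => f ^+ 2 == f * g.

Lemma rr_leP (f g : continuousType X R) :
  reflect (forall x, f x = 0 \/ f x = g x) (rr_le f g).
Proof.
have mulE (h k : continuousType X R) x : (h * k) x = h x * k x by [].
rewrite /rr_le expr2; apply: (iffP eqP) => [fg x|fg].
- have /eqP : (f * f) x = (f * g) x by rewrite fg.
  rewrite !mulE -subr_eq0 -mulrBr mulf_eq0 subr_eq0.
  by case/orP => /eqP; [left|right].
- by apply/continuousEP => x; rewrite !mulE; have [->|->] := fg x; rewrite ?mul0r.
Qed.

Lemma rr_le_refl : reflexive rr_le.
Proof. by move=> f; rewrite /rr_le expr2. Qed.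

Lemma rr_le_anti : antisymmetric rr_le.
Proof.
move=> f g /andP[/rr_leP fg /rr_leP gf]; apply/continuousEP => x.
by have [f0|//] := fg x; have [g0|//] := gf x; rewrite f0 g0.
Qed.

Lemma rr_le_trans : transitive rr_le.
Proof.
move=> g f h /rr_leP fg /rr_leP gh; apply/rr_leP => x.
by have [->|->] := fg x; [left|exact: gh].
Qed.

HB.instance Definition _ := Order.Le_isPOrder.Build rr_display (rrC R X)
  rr_le_refl rr_le_anti rr_le_trans.

End reduced_ring_order.

Definition rr_good (R : realType) (X : topologicalType) : Prop :=
  forall f g : rrC R X, infimums [set f; g] !=set0.

(* Main.v *)
Require Import Defs.
From HB Require Import structures.
From mathcomp Require Import all_boot all_order all_algebra.
From mathcomp Require Import all_classical all_reals all_analysis.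
Import Order.TTheory GRing.Theory Num.Theory.
Import numFieldNormedType.Exports.
Local Open Scope classical_set_scope.
Local Open Scope ring_scope.

(** Let [A] be dense with dense complement and fix a point [a] of [A].  The
    functions [1] and [g x = 1 + max 0 (x - a)] have no infimum in C(A).  By
    [rr_leP] a common lower bound takes only the values [0] and [1], and it
    vanishes on the right of [a], where [g] differs from [1].  For every [b < a]
    outside [A], the points of [A] below [b] form a clopen set ([clopen_ray]),
    whose indicator is a common lower bound.  As the complement of [A] is dense,
    such cuts [b] approach [a], so an infimum would have to be [1] on the left
    of [a].  Since [A] is dense, [a] is a limit of points of [A] from both sides
    ([dense_closure_trace]), and continuity would give the infimum both values
    [0] and [1] at [a].  In other words, [A] has so many clopen subsets that the
    infimum could only be the indicator of the interior of the set where [g] is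
    [1], and that interior is not closed. *)

Lemma clopen_indic_continuous (R : realType) (X : topologicalType) (U : set X) :
  clopen U -> continuous (\1_U : X -> R).
Proof.
move=> [oU cU] x.
have [Ux|nUx] := pselect (U x).
  apply: (@near_cst_continuous _ _ (1 : R)); near=> y.
  by rewrite indicE mem_set//; near: y; exact: open_nbhs_nbhs.
apply: (@near_cst_continuous _ _ (0 : R)); near=> y.
rewrite indicE memNset//; near: y.
by apply: open_nbhs_nbhs; split=> //; rewrite openC.
Unshelve. all: by end_near. Qed.

Lemma set_val_continuous (X : topologicalType) (A : set X) :
  continuous (set_val : set_type A -> X).
Proof. exact: initial_continuous. Qed.

(** Openness of [U] matters: a neighbourhood of [a] meets [U] in an open set,
    which the dense set [A] then meets. *)
Lemma dense_closure_trace (X : topologicalType) (A U : set X) (a : set_type A) :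
  dense A -> open U -> closure U (set_val a) ->
  closure (set_val @^-1` U : set (set_type A)) a.
Proof.
move=> hA oU Ua W [_ [[V oV <-] Va VW]].
have [x [Ux Vx]] : U `&` V !=set0 by apply: Ua; exact: open_nbhs_nbhs.
have [y [[Uy Vy] Ay]] : (U `&` V) `&` A !=set0.
  by apply: hA; [exists x|exact: openI].
by exists (SigSub (mem_set Ay)); split=> //; exact: VW.
Qed.

Lemma continuous_cst_closure (R : realType) (X : topologicalType)
    (h : X -> R) (D : set X) (c : R) (a : X) :
  continuous h -> (forall x, D x -> h x = c) -> closure D a -> h a = c.
Proof.
move=> ch hD Da.
have cl : closed (h @^-1` [set c]).
  exact: (iffLR (continuous_closedP h) ch _ (@closed_eq R c)).
by apply: cl; apply: closureS Da.
Qed.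

(** As [b] is missing from [A], the open and the closed ray below [b] have the
    same trace on [A]. *)
Lemma clopen_ray (R : realType) (A : set R) (b : R) :
  ~ A b -> clopen [set x : set_type A | set_val x < b].
Proof.
move=> nAb; split.
  exact: (iffLR (continuousP _) (@set_val_continuous _ A) _ (@open_lt R b)).
have -> : [set x : set_type A | set_val x < b] = set_val @^-1` [set x | x <= b].
  apply/seteqP; split=> x /=; first exact: ltW.
  rewrite le_eqVlt => /predU1P[xb|//].
  by case: nAb; rewrite -xb; exact: set_valP.
exact: (iffLR (continuous_closedP _) (@set_val_continuous _ A) _ (@closed_le R b)).
Qed.

Lemma continuous_hinge (R : realType) (a : R) :
  continuous (fun t : R => 1 + Num.max 0 (t - a)).
Proof.
move=> t; apply: cvgD; first exact: cvg_cst.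
apply: (@continuous_max _ _ (fun=> 0) (fun u => u - a)); first exact: cvg_cst.
by apply: cvgB; [exact: cvg_id|exact: cvg_cst].
Qed.

Lemma dense_codense_not_rr_good (R : realType) (A : set R) :
  dense A -> dense (~` A) -> ~ rr_good R (set_type A).
Proof.
move=> hA hAC good.
have [a0 [_ Aa0]] : [set: R] `&` A !=set0 by apply: hA; [exists 0|exact: openT].
pose a : set_type A := SigSub (mem_set Aa0).
have cg : continuous
    ((fun t => 1 + Num.max 0 (t - a0)) \o set_val : set_type A -> R).
  move=> x; apply: continuous_comp; first exact: set_val_continuous.
  exact: continuous_hinge.
pose f1 : continuousType (set_type A) R := 1.
pose g : continuousType (set_type A) R := mkcts cg.
have gE x : g x = 1 + Num.max 0 (set_val x - a0) by [].
have f1E x : f1 x = 1 by [].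
have [h0 [hlb hub]] := good f1 g.
pose h : continuousType (set_type A) R := h0.
have /rr_leP hf1 : rr_le h f1 by apply: (hlb f1); left.
have /rr_leP hg : rr_le h g by apply: (hlb g); right.
have h_right x : a0 < set_val x -> h x = 0.
  move=> ax; have [//|] := hf1 x; rewrite f1E => h1; have [//|] := hg x.
  rewrite h1 gE max_r ?subr_ge0 ?ltW// => /eqP.
  by rewrite eq_sym -subr_eq0 addrAC subrr add0r subr_eq0 gt_eqF.
have h_left x : set_val x < a0 -> h x = 1.
  move=> xa.
  (* a cut outside [A] strictly between [x] and [a0]; its indicator is a lower
     bound of [f1] and [g], hence lies below [h], and it is [1] at [x] *)
  have [b [/andP[xb ba] nAb]] : [set b | set_val x < b < a0] `&` ~` A !=set0.
    apply: hAC; first by exists ((set_val x + a0) / 2); rewrite /= !midf_lt.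
    by rewrite -set_itvoo; exact: interval_open.
  pose k : continuousType (set_type A) R :=
    mkcts (@clopen_indic_continuous R _ _ (clopen_ray _ _ _ nAb)).
  have kE y : k y = \1_[set x : set_type A | set_val x < b] y by [].
  have kh : rr_le k h.
    apply: (hub k) => _ [->|->]; apply/rr_leP => y; rewrite kE indicE;
      case: (asboolP (set_val y < b)) => yb.
    - by right; rewrite mem_set.
    - by left; rewrite memNset.
    - right; rewrite mem_set// gE max_l ?addr0// subr_le0 ltW//.
      exact: lt_trans ba.
    - by left; rewrite memNset.
  have /rr_leP/(_ x) := kh.
  by rewrite kE indicE mem_set// => -[/eqP|<-//]; rewrite oner_eq0.
have ha1 : h a = 1.
  apply: (continuous_cst_closure _ _ h _ _ _ cts_fun h_left).
  apply: (@dense_closure_trace _ A [set x | x < a0]) => //.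
  by rewrite closure_lt /=.
have ha0 : h a = 0.
  apply: (continuous_cst_closure _ _ h _ _ _ cts_fun h_right).
  apply: (@dense_closure_trace _ A [set x | a0 < x]) => //.
  by rewrite closure_gt /=.
by move: ha1; rewrite ha0 => /eqP; rewrite eq_sym oner_eq0.
Qed.

(* [set_type A] carries the subspace topology (initial for [set_val]), unlike
   the library's [subspace A]. *)
Theorem mainTheorem4 (R : realType) (A B : set R)
    (hcover : A `|` B = [set: R]) (hdisj : A `&` B = set0)
    (hA : dense A) (hB : dense B) :
  ~ rr_good R (set_type A) /\ ~ rr_good R (set_type B).
Proof.
have BE : B = ~` A.
  apply/seteqP; split=> x.
    by move=> Bx Ax; rewrite -[False]/(set0 x) -hdisj.
  by move=> nAx; have : (A `|` B) x by [rewrite hcover|]; case.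
split; apply: dense_codense_not_rr_good; rewrite ?BE ?setCK -?BE//.
Qed.
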